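(* $\mathcal F=\mathcal N_1^-/\!\sim$ decomposes into exactly two $N^-$-orbits: $$\mathcal F=N^-\cdot[P^-]\ \amalg\ N^-\cdot[\sigma P^-],$$ where $$N^-\cdot[P^-]=\{[X]\in\mathcal F:(X|\sigma P^-)>0\}=\{[X]\in\mathcal F:(X|\sigma P^-)\neq0\},$$ $$N^-\cdot[\sigma P^-]=\{[X]\in\mathcal F:(X|\sigma P^-)=0\}=\{[\sigma P^-]\}.$$
   Context: Octonions: $\mathbf O$ is the real division algebra of octonions with standard basis $1=e_0,e_1,\dots,e_7$, conjugation $x\mapsto\overline x$, inner product $(x|y)=\mathrm{Re}(x\overline y)$, and $\mathrm{Im}\,\mathbf O=\mathrm{span}_{\mathbb R}(e_1,\dots,e_7)$. Jordan algebra: for $\xi_i\in\mathbb R$, $x_i\in\mathbf O$ let $$h^1(\xi_1,\xi_2,\xi_3;x_1,x_2,x_3)=\begin{pmatrix}\xi_1&\sqrt{-1}x_3&\sqrt{-1}\,\overline{x_2}\\ \sqrt{-1}\,\overline{x_3}&\xi_2&x_1\\ \sqrt{-1}x_2&\overline{x_1}&\xi_3\end{pmatrix}$$ (entries in $\mathbf O\otimes_{\mathbb R}\mathbb C$). $\mathcal J^1$ is the real vector space of all these matrices, with Jordan product $X\circ Y=\frac12(XY+YX)$, trace $\mathrm{tr}(X)=\xi_1+\xi_2+\xi_3$, bilinear form $(X|Y)=\mathrm{tr}(X\circ Y)=\sum\xi_i\eta_i+2(x_1|y_1)-2(x_2|y_2)-2(x_3|y_3)$. For $X=h^1(\xi_1,\xi_2,\xi_3;x_1,x_2,x_3)$,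 $X^{\times2}=h^1(\xi_2\xi_3-(x_1|x_1),\ \xi_3\xi_1+(x_2|x_2),\ \xi_1\xi_2+(x_3|x_3);\ -\overline{x_2x_3}-\xi_1x_1,\ \overline{x_3x_1}-\xi_2x_2,\ \overline{x_1x_2}-\xi_3x_3)$. $E_1=h^1(1,0,0;0,0,0)$, $P^-=h^1(-1,1,0;0,0,1)$, and $\sigma h^1(\xi_1,\xi_2,\xi_3;x_1,x_2,x_3)=h^1(\xi_1,\xi_2,\xi_3;x_1,-x_2,-x_3)$, so $\sigma P^-=h^1(-1,1,0;0,0,-1)$. Group: $\mathrm F_{4(-20)}=\{g\in \mathrm{GL}_{\mathbb R}(\mathcal J^1): g(X\circ Y)=gX\circ gY\}$, with Lie algebra $\mathfrak f_{4(-20)}$; $\exp$ is the exponential of linear maps. Operators in $\mathfrak f_{4(-20)}$: for $a\in\mathbf O$, on $X=h^1(\xi_1,\xi_2,\xi_3;x_1,x_2,x_3)$, $\tilde A_1^1(a)X=h^1(0,2(a|x_1),-2(a|x_1);-(\xi_2-\xi_3)a,-\overline{x_3a},\overline{ax_2})$, $\tilde A_2^1(a)X=h^1(2(a|x_2),0,-2(a|x_2);-\overline{ax_3},-(\xi_3-\xi_1)a,-\overline{x_1a})$, $\tilde A_3^1(a)X=h^1(-2(a|x_3),2(a|x_3),0;\overline{x_2a},\overline{ax_1},-(\xi_1-\xi_2)a)$; for $p\in\mathrm{Im}\,\mathbf O$, $\delta(p)X=h^1(0,0,0;px_1,x_2p,-(px_3+x_3p))$. Put $\mathcal G_{-1}(x)=\tilde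 A_1^1(x)+\tilde A_2^1(\overline x)$, $\mathcal G_{-2}(p)=\tilde A_3^1(p)-\delta(p)$, and $N^-=\{\exp(\mathcal G_{-1}(x)+\mathcal G_{-2}(p)):x\in\mathbf O,\ p\in\mathrm{Im}\,\mathbf O\}$ (a subgroup). $\mathcal N_1^-=\{X\in\mathcal J^1: X^{\times2}=0,\ \mathrm{tr}(X)=0,\ (E_1|X)<0\}$, which is an $\mathrm F_{4(-20)}$-orbit. For $X,Y\in\mathcal N_1^-$, $X\sim Y$ iff $Y=rX$ for some $r>0$; $[X]$ is the class of $X$; $\mathrm F_{4(-20)}$ acts on $\mathcal F$ by $g[X]=[gX]$. *)

(* Defs.v *)
From mathcomp Require Import all_boot all_order all_algebra.
From mathcomp Require Import all_classical all_reals all_analysis.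
From mathcomp Require Import complex.
From mathcomp Require Import ring.

Set Implicit Arguments.
Unset Strict Implicit.
Unset Printing Implicit Defensive.

Import Order.TTheory GRing.Theory Num.Theory.
Import numFieldNormedType.Exports.

Local Open Scope classical_set_scope.
Local Open Scope ring_scope.

Section Octonions.
Variable K : comNzRingType.

(* Coordinates with respect to e_0, ..., e_7.  The scalar ring is arbitrary so
   that the same product also describes the complexification over R[i]. *)
Definition oct := 'rV[K]_8.

Definition oc (x : oct) (i : nat) : K := x 0 (inord i).
Definition oct_of (s : seq K) : oct := \row_(k < 8) nth 0 s k.

Definition oe (i : nat) : oct := delta_mx 0 (inord i).
Definition ore (x : oct) : K := oc x 0.
Definition oconj (x : oct) : oct :=
  \row_(k < 8) (if k == 0 then x 0 k else - x 0 k).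

(* Cayley-Dickson product (a, b)(c, d) = (ac - d^* b, b c^* + d a) on pairs of
   quaternions a = (x_0, ..., x_3), b = (x_4, ..., x_7), where e_1 e_2 = e_3. *)
Definition omul (x y : oct) : oct :=
  let X := oc x in let Y := oc y in
  oct_of
  [:: X 0 * Y 0 - X 1 * Y 1 - X 2 * Y 2 - X 3 * Y 3
    - X 4 * Y 4 - X 5 * Y 5 - X 6 * Y 6 - X 7 * Y 7;
      X 0 * Y 1 + X 1 * Y 0 + X 2 * Y 3 - X 3 * Y 2
    + X 4 * Y 5 - X 5 * Y 4 - X 6 * Y 7 + X 7 * Y 6;
      X 0 * Y 2 - X 1 * Y 3 + X 2 * Y 0 + X 3 * Y 1
    + X 4 * Y 6 + X 5 * Y 7 - X 6 * Y 4 - X 7 * Y 5;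
      X 0 * Y 3 + X 1 * Y 2 - X 2 * Y 1 + X 3 * Y 0
    + X 4 * Y 7 - X 5 * Y 6 + X 6 * Y 5 - X 7 * Y 4;
      X 0 * Y 4 - X 1 * Y 5 - X 2 * Y 6 - X 3 * Y 7
    + X 4 * Y 0 + X 5 * Y 1 + X 6 * Y 2 + X 7 * Y 3;
      X 0 * Y 5 + X 1 * Y 4 - X 2 * Y 7 + X 3 * Y 6
    - X 4 * Y 1 + X 5 * Y 0 - X 6 * Y 3 + X 7 * Y 2;
      X 0 * Y 6 + X 1 * Y 7 + X 2 * Y 4 - X 3 * Y 5
    - X 4 * Y 2 + X 5 * Y 3 + X 6 * Y 0 - X 7 * Y 1;
      X 0 * Y 7 - X 1 * Y 6 + X 2 * Y 5 + X 3 * Y 4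
    - X 4 * Y 3 - X 5 * Y 2 + X 6 * Y 1 + X 7 * Y 0]%R.

Definition odot (x y : oct) : K := ore (omul x (oconj y)).

Lemma oc_of (s : seq K) (i : nat) : (i < 8)%N -> oc (oct_of s) i = nth 0 s i.
Proof. by move=> i8; rewrite /oc mxE inordK. Qed.

Lemma oc_conj (x : oct) (i : nat) : (i < 8)%N ->
  oc (oconj x) i = if i == 0%N then oc x i else - oc x i.
Proof. by move=> i8; rewrite /oc mxE -val_eqE /= inordK. Qed.

Lemma oc_e (i j : nat) : (i < 8)%N -> (j < 8)%N -> oc (oe i) j = (j == i)%:R.
Proof. by move=> i8 j8; rewrite /oc mxE eqxx -val_eqE /= !inordK. Qed.

Lemma octP (x y : oct) : (forall i, (i < 8)%N -> oc x i = oc y i) -> x = y.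
Proof. by move=> xy; apply/rowP => i; rewrite -(inord_val i); exact: xy. Qed.

Lemma odotE (x y : oct) : odot x y = \sum_(i < 8) oc x i * oc y i.
Proof.
rewrite /odot /ore /omul oc_of //= !oc_conj //= !big_ord_recl big_ord0 /=.
by rewrite !mulrN !opprK addr0 !addrA.
Qed.

Lemma omul1x (x : oct) : omul (oe 0) x = x.
Proof.
by apply: octP; do 8 (case=> [_|]; first by rewrite oc_of //= !oc_e //=; ring).
Qed.

Lemma omulx1 (x : oct) : omul x (oe 0) = x.
Proof.
by apply: octP; do 8 (case=> [_|]; first by rewrite oc_of //= !oc_e //=; ring).
Qed.

(* A unital composition algebra: with positivity of [odot] over the reals and
   dimension 8 this determines the algebra up to isomorphism (Hurwitz). *)
Lemma odot_mul (x y : oct) :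
  odot (omul x y) (omul x y) = odot x x * odot y y.
Proof.
by rewrite !odotE !big_ord_recl !big_ord0 /= /bump /= !oc_of //=; ring.
Qed.

Lemma omul_conjr (x y : oct) :
  omul y (oconj x) = (2 * odot x y) *: oe 0 - omul x (oconj y).
Proof.
rewrite odotE !big_ord_recl big_ord0 /= /bump /=.
apply: octP; do 8 (case=> [_|]; first by
  rewrite {2}/oc !mxE -!/(oc _ _) !oc_of //= !oc_conj //= -?val_eqE /= ?inordK
    //=; ring).
by [].
Qed.

Lemma omul_conjl (x y : oct) :
  omul (oconj y) x = (2 * odot x y) *: oe 0 - omul (oconj x) y.
Proof.
rewrite odotE !big_ord_recl big_ord0 /= /bump /=.
apply: octP; do 8 (case=> [_|]; first by
  rewrite {2}/oc !mxE -!/(oc _ _) !oc_of //= !oc_conj //= -?val_eqE /= ?inordK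
    //=; ring).
by [].
Qed.

End Octonions.

Arguments oe {K} i.

Section Jordan.
Variable R : realType.

Definition ImO : {vspace oct R} := <<[seq oe i | i <- iota 1 7]>>%VS.

Lemma ImOE (p : oct R) : (p \in ImO) = (ore p == 0).
Proof.
apply/idP/eqP => [|p0].
  rewrite /ImO => /coord_span ->; rewrite /ore /oc summxE big1 // => i _.
  have iS : (i < size [seq (oe k : oct R) | k <- iota 1 7])%N by [].
  have /mapP[j] := mem_nth 0 iS; rewrite mem_iota => /andP[j1 j8] /= ->.
  by rewrite mxE -/(oc (oe j) 0) oc_e // (ltn_eqF j1) mulr0.
have -> : p = \sum_(1 <= i < 8) oc p i *: oe i.
  apply: octP => j j8; rewrite {2}/oc summxE.
  under eq_big_nat => i /andP[_ i8] do rewrite mxE -/(oc (oe i) j) oc_e //.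
  rewrite unlock /=.
  by move: j j8; do 8 (case=> [_|]; first by rewrite /= -?[oc p 0]/(ore p) ?p0; ring).
rewrite big_nat; apply: memv_suml => i /andP[i1 i8].
by apply: memvZ; apply: memv_span; apply: map_f; rewrite mem_iota i1.
Qed.

(* The real vector space J^1, in the coordinates (xi_1,xi_2,xi_3,x_1,x_2,x_3);
   [h1mx] below gives the matrix with these coordinates. *)
Definition J1 := (R * R * R * oct R * oct R * oct R)%type.

Definition h1 (a1 a2 a3 : R) (x1 x2 x3 : oct R) : J1 := (a1, a2, a3, x1, x2, x3).

Definition jtr (X : J1) : R := let: (a1, a2, a3, _, _, _) := X in a1 + a2 + a3.

Definition jform (X Y : J1) : R :=
  let: (a1, a2, a3, x1, x2, x3) := X in
  let: (b1, b2, b3, y1, y2, y3) := Y in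
  a1 * b1 + a2 * b2 + a3 * b3
    + 2 * odot x1 y1 - 2 * odot x2 y2 - 2 * odot x3 y3.

Definition sq2 (X : J1) : J1 :=
  let: (a1, a2, a3, x1, x2, x3) := X in
  h1 (a2 * a3 - odot x1 x1) (a3 * a1 + odot x2 x2) (a1 * a2 + odot x3 x3)
     (- oconj (omul x2 x3) - a1 *: x1)
     (oconj (omul x3 x1) - a2 *: x2)
     (oconj (omul x1 x2) - a3 *: x3).

Definition E1 : J1 := h1 1 0 0 0 0 0.
Definition Pm : J1 := h1 (-1) 1 0 0 0 (oe 0).
Definition jsigma (X : J1) : J1 :=
  let: (a1, a2, a3, x1, x2, x3) := X in h1 a1 a2 a3 x1 (- x2) (- x3).

Definition A1 (a : oct R) (X : J1) : J1 :=
  let: (a1, a2, a3, x1, x2, x3) := X in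
  h1 0 (2 * odot a x1) (- (2 * odot a x1))
     (- ((a2 - a3) *: a)) (- oconj (omul x3 a)) (oconj (omul a x2)).

Definition A2 (a : oct R) (X : J1) : J1 :=
  let: (a1, a2, a3, x1, x2, x3) := X in
  h1 (2 * odot a x2) 0 (- (2 * odot a x2))
     (- oconj (omul a x3)) (- ((a3 - a1) *: a)) (- oconj (omul x1 a)).

Definition A3 (a : oct R) (X : J1) : J1 :=
  let: (a1, a2, a3, x1, x2, x3) := X in
  h1 (- (2 * odot a x3)) (2 * odot a x3) 0
     (oconj (omul x2 a)) (oconj (omul a x1)) (- ((a1 - a2) *: a)).

Definition delta (p : oct R) (X : J1) : J1 :=
  let: (_, _, _, x1, x2, x3) := X in
  h1 0 0 0 (omul p x1) (omul x2 p) (- (omul p x3 + omul x3 p)).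

Definition Gm1 (x : oct R) (X : J1) : J1 := A1 x X + A2 (oconj x) X.
Definition Gm2 (p : oct R) (X : J1) : J1 := A3 p X - delta p X.

(* J^1 is finite-dimensional, so the limit of the exponential series of an
   operator can be taken pointwise. *)
Definition expL (A : J1 -> J1) (X : J1) : J1 :=
  limn (fun n => \sum_(0 <= k < n) (k`!%:R : R)^-1 *: iter k A X).

Definition Nm : set (J1 -> J1) :=
  [set expL (fun X => Gm1 x X + Gm2 p X) | x in setT & p in [set` ImO]].

Definition N1m : set J1 := [set X | [/\ sq2 X = 0, jtr X = 0 & jform E1 X < 0]].

Definition simN (X Y : J1) : Prop := exists2 r : R, 0 < r & Y = r *: X.

(* Elements of the quotient are the classes themselves, as subsets of N1m. *)
Definition cls (X : J1) : set J1 := [set Y | N1m Y /\ simN X Y].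
Definition Fq : set (set J1) := [set cls X | X in N1m].

(* g[X] = [gX]; the union over representatives spares a choice. *)
Definition actF (g : J1 -> J1) (c : set J1) : set J1 :=
  \bigcup_(X in c) cls (g X).
Definition Norbit (c : set J1) : set (set J1) := [set actF g c | g in Nm].

(* From here on, [jform] is identified with (X|Y) = tr(X o Y), the Jordan product
   being that of 3 x 3 matrices over the complexified octonions. *)
Definition ocplx (z : R[i]) (x : oct R) : oct R[i] :=
  z *: map_mx (real_complex R) x.

Definition mx3 (rows : seq (seq (oct R[i]))) : 'M[oct R[i]]_3 :=
  \matrix_(i < 3, j < 3) nth 0 (nth [::] rows i) j.

Definition h1mx (X : J1) : 'M[oct R[i]]_3 :=
  let: (a1, a2, a3, x1, x2, x3) := X in
  mx3
    [:: [:: ocplx a1%:C%C (oe 0); ocplx 'i%C x3; ocplx 'i%C (oconj x2)];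
        [:: ocplx 'i%C (oconj x3); ocplx a2%:C%C (oe 0); ocplx 1 x1];
        [:: ocplx 'i%C x2; ocplx 1 (oconj x1); ocplx a3%:C%C (oe 0)]].

Definition jordan_mx (A B : 'M[oct R[i]]_3) : 'M[oct R[i]]_3 :=
  \matrix_(i, j) (2^-1 *: \sum_k (omul (A i k) (B k j) + omul (B i k) (A k j))).

Lemma omul_ocplx z w (x y : oct R) :
  omul (ocplx z x) (ocplx w y) = ocplx (z * w) (omul x y).
Proof.
have ocC u (v : oct R) i : oc (ocplx u v) i = u * (oc v i)%:C%C.
  by rewrite /oc !mxE.
have cM (a b : R) : (a * b)%:C%C = a%:C%C * b%:C%C by rewrite rmorphM.
have cB (a b : R) : (a - b)%:C%C = a%:C%C - b%:C%C by rewrite rmorphB.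
have cD (a b : R) : (a + b)%:C%C = a%:C%C + b%:C%C by rewrite rmorphD.
apply: octP; do 8 (case=> [_|]; first by
  rewrite ocC !oc_of //= !ocC !(cB, cD, cM); ring).
by [].
Qed.

Lemma tr_jordan_mx3 (a11 a12 a13 a21 a22 a23 a31 a32 a33
    b11 b12 b13 b21 b22 b23 b31 b32 b33 : oct R[i]) :
  \tr (jordan_mx (mx3 [:: [:: a11; a12; a13];
                            [:: a21; a22; a23]; [:: a31; a32; a33]])
                  (mx3 [:: [:: b11; b12; b13];
                            [:: b21; b22; b23]; [:: b31; b32; b33]])) =
    2^-1 *: ((omul a11 b11 + omul b11 a11)
           + (omul a12 b21 + omul b12 a21)
           + (omul a13 b31 + omul b13 a31))
  + 2^-1 *: ((omul a21 b12 + omul b21 a12)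
           + (omul a22 b22 + omul b22 a22)
           + (omul a23 b32 + omul b23 a32))
  + 2^-1 *: ((omul a31 b13 + omul b31 a13)
           + (omul a32 b23 + omul b32 a23)
           + (omul a33 b33 + omul b33 a33)).
Proof.
rewrite /mxtrace 3!big_ord_recl big_ord0 addr0 addrA.
rewrite /jordan_mx; move: (@omul _) => m.
by congr (_ + _ + _); rewrite mxE 3!big_ord_recl big_ord0 addr0 addrA !mxE.
Qed.

Lemma jform_jordan_mx (X Y : J1) :
  \tr (jordan_mx (h1mx X) (h1mx Y)) = ocplx (jform X Y)%:C%C (oe 0).
Proof.
case: X => [[[[[a1 a2] a3] x1] x2] x3]; case: Y => [[[[[b1 b2] b3] y1] y2] y3].
rewrite /h1mx tr_jordan_mx3 !omul_ocplx !omul1x.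
rewrite (omul_conjr x1 y1) (omul_conjr x2 y2) (omul_conjr x3 y3).
rewrite (omul_conjl x1 y1) (omul_conjl x2 y2) (omul_conjl x3 y3).
rewrite -!expr2 !sqr_i /jform.
move: (odot x1 y1) (odot x2 y2) (odot x3 y3) (oe 0 : oct R) => d1 d2 d3 e.
move: (omul x1 _) (omul x2 _) (omul x3 _) (omul (oconj x1) _)
  (omul (oconj x2) _) (omul (oconj x3) _) => u1 u2 u3 v1 v2 v3.
apply/rowP => j.
have cD (u v : oct R[i]) : (u + v) 0 j = u 0 j + v 0 j by rewrite mxE.
have cZ z (u : oct R[i]) : (z *: u) 0 j = z * u 0 j by rewrite mxE.
have cE z (u : oct R) : ocplx z u 0 j = z * (u 0 j)%:C%C by rewrite !mxE.
have cB c (u v : oct R) : (c *: u - v) 0 j = c * u 0 j - v 0 j by rewrite !mxE.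
move: (ocplx) cE => P cE; rewrite !(cD, cZ) !cE !cB.
have cM (a b : R) : (a * b)%:C%C = a%:C%C * b%:C%C by rewrite rmorphM.
have cN (a b : R) : (a - b)%:C%C = a%:C%C - b%:C%C by rewrite rmorphB.
have cP (a b : R) : (a + b)%:C%C = a%:C%C + b%:C%C by rewrite rmorphD.
have c1 : (1 : R)%:C%C = 1 by rewrite rmorph1.
rewrite !(cP, cN, cM) !c1.
by field.
Qed.

End Jordan.

Arguments Fq R : clear implicits.

(* Main.v *)
Require Import Defs.
From mathcomp Require Import all_boot all_order all_algebra.
From mathcomp Require Import all_classical all_reals all_analysis.
From mathcomp Require Import ring lra.

Set Implicit Arguments.
Unset Strict Implicit.
Unset Printing Implicit Defensive.

Import Order.TTheory GRing.Theory Num.Theory.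
Import numFieldNormedType.Exports.

Local Open Scope classical_set_scope.
Local Open Scope ring_scope.

(** The operators L = G_{-1}(x) + G_{-2}(p) kill sigma P^- and satisfy
    L^5 P^- = 0, so exp L fixes sigma P^- and exp L P^- is an explicit
    polynomial in x and p, normalized by (exp L P^- | sigma P^-) = 4.
    For X = h^1(xi_1, xi_2, xi_3; x_1, x_2, x_3) in N_1^- one finds
    - xi_1 (X | sigma P^-) = |x_3 - xi_1|^2.  Hence the form is nonnegative, it
    vanishes only on the ray of sigma P^-, and otherwise X can be rescaled to
    (X | sigma P^-) = 4; then x and p with X = exp L P^- are read off as
    x = - (x_1 + conj x_2) / 4 and p = Im x_3 / 4. *)

(** * Octonion algebra: bilinearity, conjugation, alternativity, adjoints *)

Section OctonionLaws.
Variable K : comNzRingType.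
Implicit Types (x y z p : oct K) (c : K).

Lemma ocD x y i : oc (x + y) i = oc x i + oc y i.
Proof. by rewrite /oc mxE. Qed.

Lemma ocN x i : oc (- x) i = - oc x i.
Proof. by rewrite /oc mxE. Qed.

Lemma ocZ c x i : oc (c *: x) i = c * oc x i.
Proof. by rewrite /oc mxE. Qed.

Lemma oc0 i : oc (0 : oct K) i = 0.
Proof. by rewrite /oc mxE. Qed.

Lemma odot_coord x y : odot x y =
  oc x 0 * oc y 0 + oc x 1 * oc y 1 + oc x 2 * oc y 2 + oc x 3 * oc y 3
  + oc x 4 * oc y 4 + oc x 5 * oc y 5 + oc x 6 * oc y 6 + oc x 7 * oc y 7.
Proof. by rewrite odotE !big_ord_recl big_ord0 /= addr0 !addrA. Qed.

(** Proves an octonion identity as eight polynomial identities in the coordinates. The index left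
    after the eight splits is at least 8 and contradicts its bound. *)
Ltac oct_ring :=
  rewrite ?odot_coord; apply: octP;
  do 8 (case=> [_|];
    [rewrite ?(ocD, ocN, ocZ) ?oc_of //= ?(ocD, ocN, ocZ, oc_of, oc_conj) //=
       ?(ocD, ocN, ocZ, oc_of, oc_conj, oc_e) //=; ring|]);
  by [].

Lemma omulDl x y z : omul (x + y) z = omul x z + omul y z.
Proof. oct_ring. Qed.

Lemma omulDr x y z : omul z (x + y) = omul z x + omul z y.
Proof. oct_ring. Qed.

Lemma omulZl c x y : omul (c *: x) y = c *: omul x y.
Proof. oct_ring. Qed.

Lemma omulZr c x y : omul x (c *: y) = c *: omul x y.
Proof. oct_ring. Qed.

Lemma omulNl x y : omul (- x) y = - omul x y.
Proof. by rewrite -scaleN1r omulZl scaleN1r. Qed.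

Lemma omulNr x y : omul x (- y) = - omul x y.
Proof. by rewrite -scaleN1r omulZr scaleN1r. Qed.

Lemma omul0l x : omul 0 x = 0.
Proof. by rewrite -(scale0r (0 : oct K)) omulZl !scale0r. Qed.

Lemma omul0r x : omul x 0 = 0.
Proof. by rewrite -(scale0r (0 : oct K)) omulZr !scale0r. Qed.

Lemma oconjD x y : oconj (x + y) = oconj x + oconj y.
Proof. oct_ring. Qed.

Lemma oconjZ c x : oconj (c *: x) = c *: oconj x.
Proof. oct_ring. Qed.

Lemma oconjN x : oconj (- x) = - oconj x.
Proof. by rewrite -scaleN1r oconjZ scaleN1r. Qed.

Lemma oconj0 : oconj (0 : oct K) = 0.
Proof. by rewrite -(scale0r (0 : oct K)) oconjZ !scale0r. Qed.

Lemma oconj1 : oconj (oe 0 : oct K) = oe 0.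
Proof. oct_ring. Qed.

Lemma oconjK x : oconj (oconj x) = x.
Proof. oct_ring. Qed.

Lemma oconjM x y : oconj (omul x y) = omul (oconj y) (oconj x).
Proof. oct_ring. Qed.

Lemma oconjE x : oconj x = (2 * ore x) *: oe 0 - x.
Proof. rewrite /ore; oct_ring. Qed.

(** Alternativity in the form that replaces associativity from here on: a factor next to its
    conjugate cancels to its norm. *)
Lemma omulKconj x y : omul x (omul (oconj x) y) = odot x x *: y.
Proof. oct_ring. Qed.

Lemma omul_conjK x y : omul (omul y x) (oconj x) = odot x x *: y.
Proof. oct_ring. Qed.

Lemma omul_conj x : omul x (oconj x) = odot x x *: oe 0.
Proof. oct_ring. Qed.

Lemma odotC x y : odot x y = odot y x.
Proof. rewrite !odot_coord; ring. Qed.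

Lemma odotDl x y z : odot (x + y) z = odot x z + odot y z.
Proof. rewrite !odot_coord !ocD; ring. Qed.

Lemma odotZl c x y : odot (c *: x) y = c * odot x y.
Proof. rewrite !odot_coord !ocZ; ring. Qed.

Lemma odotNl x y : odot (- x) y = - odot x y.
Proof. by rewrite -scaleN1r odotZl mulN1r. Qed.

Lemma odot0l x : odot 0 x = 0.
Proof. by rewrite -(scale0r (0 : oct K)) odotZl mul0r. Qed.

Lemma odotDr x y z : odot z (x + y) = odot z x + odot z y.
Proof. by rewrite !(odotC z) odotDl. Qed.

Lemma odotZr c x y : odot x (c *: y) = c * odot x y.
Proof. by rewrite !(odotC x) odotZl. Qed.

Lemma odotNr x y : odot x (- y) = - odot x y.
Proof. by rewrite !(odotC x) odotNl. Qed.

Lemma odot0r x : odot x 0 = 0.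
Proof. by rewrite odotC odot0l. Qed.

Lemma odot1r x : odot x (oe 0) = ore x.
Proof. by rewrite odot_coord !oc_e //= /ore; ring. Qed.

Lemma odot1l x : odot (oe 0) x = ore x.
Proof. by rewrite odotC odot1r. Qed.

Lemma odot_oconj x y : odot (oconj x) (oconj y) = odot x y.
Proof. by rewrite !odot_coord !oc_conj //=; ring. Qed.

Lemma odot_mulr x y z : odot x (omul y z) = odot (omul (oconj y) x) z.
Proof. by rewrite !odot_coord !oc_of //= !oc_conj //=; ring. Qed.

Lemma odot_mull x y z : odot x (omul y z) = odot (omul x (oconj z)) y.
Proof. by rewrite !odot_coord !oc_of //= !oc_conj //=; ring. Qed.

Lemma oconj_imag p : ore p = 0 -> oconj p = - p.
Proof. by move=> p0; rewrite oconjE p0 mulr0 scale0r sub0r. Qed.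

Lemma omul_imagK p y : ore p = 0 -> omul p (omul p y) = - odot p p *: y.
Proof.
by move=> p0; rewrite scaleNr -omulKconj oconj_imag // omulNl omulNr opprK.
Qed.

Lemma omulK_imag p y : ore p = 0 -> omul (omul y p) p = - odot p p *: y.
Proof.
by move=> p0; rewrite scaleNr -omul_conjK oconj_imag // omulNr opprK.
Qed.

Lemma omul_imag p : ore p = 0 -> omul p p = - odot p p *: oe 0.
Proof. by move=> p0; rewrite -{2}(omulx1 p) omul_imagK. Qed.

Lemma omul_oconj x : omul (oconj x) x = odot x x *: oe 0.
Proof. by rewrite -{2}(oconjK x) omul_conj odot_oconj. Qed.

Lemma odot_mul_self x y : odot x (omul x y) = odot x x * ore y.
Proof. by rewrite odot_mulr omul_oconj odotZl odot1l. Qed.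

Lemma odot_self_mul x y : odot x (omul y x) = odot x x * ore y.
Proof. by rewrite odot_mull omul_conj odotZl odot1l. Qed.

Lemma odot_real_imag (c d : K) p : ore p = 0 ->
  odot (c *: oe 0 + d *: p) (c *: oe 0 + d *: p) = c ^+ 2 + d ^+ 2 * odot p p.
Proof.
move=> p0; rewrite odotDl !odotDr !odotZl !odotZr odot1l !odot1r p0 odot1l p0.
by rewrite /ore oc_e //=; ring.
Qed.

End OctonionLaws.

(** * Exponential series of operators nilpotent at a vector *)

Section ExponentialSeries.
Variable R : realType.

(** Since [A] fixes 0, all iterates from the [m]-th on vanish, so the partial sums are eventually
    constant and the limit is their common value. *)
Lemma expL_finite (A : J1 R -> J1 R) (X : J1 R) (m : nat) :
  A 0 = 0 -> iter m A X = 0 ->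
  expL A X = \sum_(0 <= k < m) (k`!%:R : R)^-1 *: iter k A X.
Proof.
move=> A0 Am; have iter0 k : iter (k + m) A X = 0.
  by elim: k => //= k ->.
apply: (@lim_near_cst (J1 R : normedModType R)); first exact: norm_hausdorff.
exists m => //= n /= mn.
rewrite (big_cat_nat (n := m)) //= [X in _ + X]big_nat [X in _ + X]big1 ?addr0 //.
by move=> k /andP[mk _]; rewrite -(subnK mk) iter0 scaler0.
Qed.

(** Serves to let exp L act on the ray of [X]; nilpotency at [X] passes to every multiple, so both
    series are finite sums. *)
Lemma expLZ (A : J1 R -> J1 R) (r : R) X (m : nat) :
  (forall c Y, A (c *: Y) = c *: A Y) -> iter m A X = 0 ->
  expL A (r *: X) = r *: expL A X.
Proof.
move=> AZ Am; have A0 : A 0 = 0 by have := AZ 0 0; rewrite !scale0r.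
have iterZ k : iter k A (r *: X) = r *: iter k A X.
  by elim: k => //= k ->; rewrite AZ.
rewrite !(@expL_finite _ _ m) // ?iterZ ?Am ?scaler0 // scaler_sumr.
by apply: eq_bigr => k _; rewrite iterZ !scalerA mulrC.
Qed.

End ExponentialSeries.

(** * The operators L in coordinates and their exponentials at P^- *)

Section Orbits.
Variable R : realType.
Implicit Types (x y p w : oct R) (X Y : J1 R).

Lemma h1D (a1 a2 a3 b1 b2 b3 : R) x1 x2 x3 y1 y2 y3 :
  h1 a1 a2 a3 x1 x2 x3 + h1 b1 b2 b3 y1 y2 y3 =
  h1 (a1 + b1) (a2 + b2) (a3 + b3) (x1 + y1) (x2 + y2) (x3 + y3).
Proof. by []. Qed.

Lemma h1N (a1 a2 a3 : R) x1 x2 x3 :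
  - h1 a1 a2 a3 x1 x2 x3 = h1 (- a1) (- a2) (- a3) (- x1) (- x2) (- x3).
Proof. by []. Qed.

Lemma h1Z (r a1 a2 a3 : R) x1 x2 x3 :
  r *: h1 a1 a2 a3 x1 x2 x3 =
  h1 (r * a1) (r * a2) (r * a3) (r *: x1) (r *: x2) (r *: x3).
Proof. by []. Qed.

(** Unlike [oct_ring], keeps octonion products as atoms: it closes identities that are linear once
    the products have been normalized. *)
Ltac oct_lin := apply: octP => ? _; rewrite ?(ocD, ocN, ocZ, oc0); ring.

Definition Lm x p X := Gm1 x X + Gm2 p X.

Lemma LmE x p (a1 a2 a3 : R) x1 x2 x3 :
  Lm x p (h1 a1 a2 a3 x1 x2 x3) =
  h1 (2 * odot (oconj x) x2 - 2 * odot p x3)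
     (2 * odot x x1 + 2 * odot p x3)
     (- (2 * odot x x1) - 2 * odot (oconj x) x2)
     ((a3 - a2) *: x - omul (oconj x3) x + oconj (omul x2 p) - omul p x1)
     (- omul (oconj x) (oconj x3) + (a1 - a3) *: oconj x + oconj (omul p x1)
       - omul x2 p)
     (oconj (omul x x2) - omul x (oconj x1) + (a2 - a1) *: p
       + (omul p x3 + omul x3 p)).
Proof.
rewrite /Lm /Gm1 /Gm2 /A1 /A2 /A3 /delta /= ?(h1N, h1D).
by rewrite !oconjM !oconjK; congr h1; (ring || oct_lin).
Qed.

Lemma LmZ x p r X : Lm x p (r *: X) = r *: Lm x p X.
Proof.
case: X => [[[[[a1 a2] a3] x1] x2] x3]; rewrite -/(h1 _ _ _ _ _ _) h1Z !LmE h1Z.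
by rewrite !(odotZr, omulZr, omulZl, oconjZ); congr h1; (ring || oct_lin).
Qed.

Lemma Lm0 x p : Lm x p 0 = 0.
Proof. by have := LmZ x p 0 0; rewrite !scale0r. Qed.

(* The listed vectors are L^k P^- / k! for k = 1, ..., 4. *)
Lemma Lm_iter x p (k : nat) : ore p = 0 ->
  iter k.+1 (Lm x p) (Pm R) = (k.+1)`!%:R *: nth 0
   [:: h1 0 0 0 (- 2 *: x) (- 2 *: oconj x) (4 *: p);
       h1 (- (2 * odot x x + 4 * odot p p)) (4 * odot p p - 2 * odot x x)
          (4 * odot x x) (4 *: omul p x) (4 *: omul (oconj x) p)
          (- 4 * odot p p *: oe 0);
       h1 0 0 0 (2 * odot x x *: x) (- 2 * odot x x *: oconj x) 0;
       h1 (- odot x x ^+ 2) (odot x x ^+ 2) 0 0 0 (- odot x x ^+ 2 *: oe 0)] k.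
Proof.
move=> p0; have pC := oconj_imag p0.
have odp1 : odot p (oe 0) = 0 by rewrite odot1r.
pose simp := (odotZr, odotNr, odot0r, odot_oconj, odot_mul_self, odot_self_mul,
  p0, odp1, oconjZ, oconjN, oconj0, oconj1, oconjM, oconjK, pC).
(* Every nested product met in the iterates has a factor beside itself or its conjugate, so
   alternativity collapses it. *)
pose simm := (omulZr, omulZl, omulNr, omulNl, omul0l, omul0r, omulx1, omul1x,
  omul_imagK _ p0, omulK_imag _ p0, omul_imag p0, omulKconj, omul_conjK, omul_conj, omul_oconj).
elim: k => [|[|[|[|k]]] IH].
- rewrite /= /Pm LmE scale1r !(simp, simm).
  by congr h1; (ring || oct_lin).
- rewrite iterS IH LmZ /= LmE !h1Z !(simp, simm) -[1`!]/1%N -[2`!]/2%N.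
  by congr h1; (ring || oct_lin).
- rewrite iterS IH LmZ /= LmE !h1Z !(simp, simm) -[2`!]/2%N -[3`!]/6%N.
  by congr h1; (ring || oct_lin).
- rewrite iterS IH LmZ /= LmE !h1Z !(simp, simm) -[3`!]/6%N -[4`!]/24%N.
  by congr h1; (ring || oct_lin).
- rewrite iterS IH LmZ.
  (* Past the end of the list [nth] returns 0; the remaining case says that L kills the fourth
     vector, that is, L^5 P^- = 0. *)
  case: k {IH} => [|k]; last by rewrite /= !nth_nil Lm0 !scaler0.
  rewrite /= LmE !(simp, simm) [h1 _ _ _ _ _ _](_ : _ = 0) ?scaler0 //.
  by congr h1; (ring || oct_lin).
Qed.

(** The closed form of exp L P^-, grouped around [w] = x_3 - xi_1, for which |w|^2 = 4 a when [p] is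
    imaginary. It parametrizes the slice (X | sigma P^-) = 4 of N_1^-. *)
Definition horo x p : J1 R :=
  let n := odot x x in
  let w := (2 * (1 + n)) *: oe 0 + 4 *: p in
  let a := (1 + n) ^+ 2 + 4 * odot p p in
  h1 (- a) (a - 4 * n) (4 * n)
     (omul w x - 4 *: x) (- omul (oconj x) (oconj w)) (w - a *: oe 0).

Lemma expL_Pm x p : ore p = 0 -> expL (Lm x p) (Pm R) = horo x p.
Proof.
move=> p0; rewrite (@expL_finite _ _ _ 5) ?Lm0 //; last by rewrite Lm_iter //= scaler0.
rewrite big_nat_recl // big_mkord.
under eq_bigr => k _ do rewrite Lm_iter // scalerA mulVf ?scale1r ?pnatr_eq0
  -?lt0n ?fact_gt0 //.
rewrite !big_ord_recl big_ord0 /=.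
rewrite /horo /= /Pm fact0 invr1 scale1r addr0 !h1D /=.
rewrite omulDl !omulZl omul1x oconjD !oconjZ oconj1 (oconj_imag p0) omulDr !omulZr
  omulx1 omulNr.
by congr h1; (ring || oct_lin).
Qed.

(** * Positivity of the norm and the equations of N_1^- *)

Lemma odot_ge0 x : 0 <= odot x x.
Proof. by rewrite odotE; apply: sumr_ge0 => i _; rewrite -expr2 sqr_ge0. Qed.

Lemma odot_eq0 x : odot x x = 0 -> x = 0.
Proof.
rewrite odotE => /eqP.
rewrite psumr_eq0 => [/allP x0|i _]; last by rewrite -expr2 sqr_ge0.
apply: octP => i i8; rewrite oc0; apply/eqP.
by have := x0 (Ordinal i8) (mem_index_enum _); rewrite /= mulf_eq0 orbb.
Qed.

Lemma Pm_sigma : jsigma (Pm R) = h1 (-1) 1 0 0 0 (- oe 0).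
Proof. by rewrite /jsigma /= oppr0. Qed.

Lemma jform_sigma_Pm (a1 a2 a3 : R) x1 x2 x3 :
  jform (h1 a1 a2 a3 x1 x2 x3) (jsigma (Pm R)) = a2 - a1 + 2 * ore x3.
Proof. by rewrite Pm_sigma /= !odot0r odotNr odot1r; ring. Qed.

Lemma N1mE (a1 a2 a3 : R) x1 x2 x3 : N1m (h1 a1 a2 a3 x1 x2 x3) <->
  [/\ [/\ odot x1 x1 = a2 * a3, odot x2 x2 = - (a3 * a1)
        & odot x3 x3 = - (a1 * a2)],
      [/\ oconj (omul x2 x3) = - a1 *: x1, oconj (omul x3 x1) = a2 *: x2
        & oconj (omul x1 x2) = a3 *: x3],
      a1 + a2 + a3 = 0 & a1 < 0].
Proof.
rewrite /N1m /= !odot0l !mulr0 !mul0r !addr0 !subr0 mul1r.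
split=> [[[e1 e2 e3 f1 f2 f3] t0 a10]|[[e1 e2 e3] [f1 f2 f3] t0 a10]].
  split=> //; split.
  - by rewrite (subr0_eq e1).
  - by rewrite -[RHS]add0r -e2 addrC addKr.
  - by rewrite -[RHS]add0r -e3 addrC addKr.
  - by rewrite scaleNr -(subr0_eq f1) opprK.
  - exact: subr0_eq.
  - exact: subr0_eq.
split=> //; rewrite e1 e2 e3 f1 f2 f3; congr h1; (ring || oct_lin).
Qed.

Lemma N1m_horo x p : ore p = 0 -> N1m (horo x p).
Proof.
move=> p0; rewrite /horo /=.
set n := odot x x; set q := odot p p.
set w := _ *: oe 0 + 4 *: p; set a := _ + 4 * q.
have n0 : 0 <= n by exact: odot_ge0.
have q0 : 0 <= q by exact: odot_ge0.
have wC : oconj w = (4 * (1 + n)) *: oe 0 - w.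
  rewrite oconjE; congr (_ *: _ - _).
  by rewrite /w /ore ocD !ocZ oc_e //= -/(ore p) p0; ring.
have ww : odot w w = 4 * a.
  rewrite /w odotDl !odotDr !odotZl !odotZr odotC !odot1r p0 -/q /a.
  by rewrite /ore oc_e //=; ring.
have rw : odot w (oe 0) = 2 * (1 + n).
  by rewrite odot1r /w /ore ocD !ocZ oc_e //= -/(ore p) p0; ring.
(* From here on [w] enters only through its conjugate, its norm and its real part. *)
clearbody w.
(* The quadratic equation w^2 = 2 Re(w) w - |w|^2, applied to [x] by alternativity. *)
have wwx : omul w (omul w x) = (4 * (1 + n)) *: omul w x - (4 * a) *: x.
  rewrite -ww -omulKconj wC omulDl omulNl omulZl omul1x omulDr omulNr omulZr.
  oct_lin.
have wxx : odot (omul w x) x = n * odot w (oe 0).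
  by rewrite odotC odot_self_mul -/n odot1r.
have wxwx : odot (omul w x) (omul w x) = 4 * a * n by rewrite odot_mul ww.
apply/N1mE; split; last first.
- by rewrite oppr_lt0 /a; nra.
- by rewrite /a; ring.
- have xww : omul (omul (oconj x) (oconj w)) w = (4 * a) *: oconj x.
    by rewrite -ww -odot_oconj -omul_conjK oconjK.
  split.
  + rewrite omulNl omulDr omulNr omulZr omulx1 xww.
    rewrite !(oconjN, oconjD, oconjZ) oconjM !oconjK; oct_lin.
  + rewrite omulDl !omulDr !(omulNl, omulNr) omulZl omulZr omul1x wwx omulZl.
    rewrite omulZr !omul1x.
    rewrite !(oconjN, oconjD, oconjZ) oconjM; oct_lin.
  + rewrite omulDl !(omulNl, omulNr) omulZl omulKconj -/n -oconjM omul_conj wxwx.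
    rewrite !(oconjN, oconjD, oconjZ) oconjK oconj1; oct_lin.
- split.
  + rewrite odotDl !odotDr !odotNl !odotNr !odotZl !odotZr (odotC x) wxx wxwx rw
      -/n /a; ring.
  + rewrite odotNl odotNr -oconjM odot_oconj wxwx; ring.
  + rewrite odotDl !odotDr !odotNl !odotNr !odotZl !odotZr (odotC (oe 0) w) rw ww.
    by rewrite odot1r /ore oc_e //= /a; ring.
Qed.

(** * The linear form (X | sigma P^-) on N_1^- *)

Lemma jform_horo x p : ore p = 0 -> jform (horo x p) (jsigma (Pm R)) = 4.
Proof.
move=> p0; rewrite /horo; lazy zeta; rewrite jform_sigma_Pm /ore !(ocD, ocN, ocZ) !oc_e //=.
by rewrite -/(ore p) p0; ring.
Qed.

(** The third diagonal entry of X^{x2} = 0 gives |x_3|^2 = - xi_1 xi_2, so - xi_1 factors out of the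
    expanded square. *)
Lemma N1m_jform_sigma_Pm (a1 a2 a3 : R) x1 x2 x3 :
  let X := h1 a1 a2 a3 x1 x2 x3 in
  N1m X -> - a1 * jform X (jsigma (Pm R))
           = odot (x3 - a1 *: oe 0) (x3 - a1 *: oe 0).
Proof.
move=> X /N1mE[[_ _ e3] _ _ _]; rewrite /X jform_sigma_Pm.
rewrite odotDl !odotDr !odotNl !odotNr !odotZl !odotZr e3 odot1l !odot1r.
by rewrite /ore oc_e //=; ring.
Qed.

Lemma N1m_jform_ge0 X : N1m X -> 0 <= jform X (jsigma (Pm R)).
Proof.
case: X => [[[[[a1 a2] a3] x1] x2] x3] NX; have [_ _ _ a10] := (N1mE _ _ _ _ _ _).1 NX.
have := odot_ge0 (x3 - a1 *: oe 0).
by rewrite -(N1m_jform_sigma_Pm NX) pmulr_rge0 // oppr_gt0.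
Qed.

(** The square vanishes, so x_3 = xi_1; comparing norms gives xi_2 = - xi_1, the trace then gives
    xi_3 = 0, and |x_1|^2 and |x_2|^2 both carry the factor xi_3. *)
Lemma N1m_jform_eq0 X : N1m X -> jform X (jsigma (Pm R)) = 0 ->
  exists2 r : R, 0 < r & X = r *: jsigma (Pm R).
Proof.
case: X => [[[[[a1 a2] a3] x1] x2] x3] NX X0.
have [[e1 e2 e3] _ t0 a10] := (N1mE _ _ _ _ _ _).1 NX.
have /subr0_eq x3E : x3 - a1 *: oe 0 = 0.
  by apply: odot_eq0; rewrite -(N1m_jform_sigma_Pm NX) X0 mulr0.
have a2E : a2 = - a1.
  move: e3; rewrite x3E odotZl odotZr odot1r /ore oc_e //= => e3.
  by apply: (mulfI (ltr0_neq0 a10)) => //; lra.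
have a3E : a3 = 0 by lra.
have x10 : x1 = 0 by apply: odot_eq0; rewrite e1 a3E mulr0.
have x20 : x2 = 0 by apply: odot_eq0; rewrite e2 a3E mul0r oppr0.
exists (- a1); first by rewrite oppr_gt0.
rewrite Pm_sigma h1Z x3E x10 x20 a2E a3E.
by congr h1; (ring || oct_lin).
Qed.

(** In [horo] the first two octonion entries are w x - 4 x and - conj (w x), so x_1 + conj x_2 = - 4
    x, which dictates the witness [x]; likewise 4 p is the imaginary part of x_3. *)
Lemma N1m_eq_horo X : N1m X -> jform X (jsigma (Pm R)) = 4 ->
  exists x p, ore p = 0 /\ X = horo x p.
Proof.
case: X => [[[[[a1 a2] a3] x1] x2] x3] NX X4.
have [[e1 e2 e3] [f1 f2 f3] t0 a10] := (N1mE _ _ _ _ _ _).1 NX.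
pose x := - 4^-1 *: (x1 + oconj x2); pose p := 4^-1 *: (x3 - ore x3 *: oe 0).
pose w := x3 - a1 *: oe 0.
have p0 : ore p = 0 by rewrite /p /ore ocZ ocD ocN ocZ oc_e //=; ring.
have ww : odot w w = - (4 * a1) by rewrite -(N1m_jform_sigma_Pm NX) X4; ring.
rewrite jform_sigma_Pm in X4.
(* By conj (x_2 x_3) = - xi_1 x_1, the product x_2 w is - xi_1 times the conjugate of x_1 + conj
   x_2. *)
have x2w : omul x2 w = (4 * a1) *: oconj x.
  rewrite omulDr omulNr omulZr omulx1 -(oconjK (omul x2 x3)) f1.
  rewrite /x !(oconjD, oconjN, oconjZ) oconjK.
  by apply: octP => i _; rewrite !(ocD, ocN, ocZ); field.
(* Multiply [x2w] on the right by conj w, where |w|^2 = - 4 xi_1, and cancel 4 xi_1. *)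
have x2E : x2 = - omul (oconj x) (oconj w).
  have : (4 * a1) *: x2 = (4 * a1) *: - omul (oconj x) (oconj w).
    by rewrite scalerN -omulZl -x2w omul_conjK ww scaleNr opprK.
  by apply: scalerI; rewrite mulf_neq0 ?pnatr_eq0 // ltr0_neq0.
(* Take norms in [x2w]. *)
have a3E : a3 = 4 * odot x x.
  have := odot_mul x2 w; rewrite x2w odotZl odotZr odot_oconj ww e2 => h.
  have : (4 * a1 * a1) * a3 = (4 * a1 * a1) * (4 * odot x x) by lra.
  by apply: mulfI; rewrite !mulf_neq0 ?pnatr_eq0 // ltr0_neq0.
have wE : w = (2 * (1 + odot x x)) *: oe 0 + 4 *: p.
  (* The trace and the normalization to 4 force Re w = 2 + xi_3 / 2. *)
  have -> : 2 * (1 + odot x x) = ore x3 - a1 by lra.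
  rewrite /p scalerA mulfV ?pnatr_eq0 // scale1r /w; oct_lin.
have a1E : - a1 = (1 + odot x x) ^+ 2 + 4 * odot p p.
  move: ww; rewrite wE odot_real_imag // => h; lra.
exists x, p; split=> //; rewrite /horo; lazy zeta; rewrite -wE -a1E -x2E.
congr h1.
- by rewrite opprK.
- lra.
- by [].
- have -> : omul w x = - oconj x2 by rewrite x2E oconjN oconjM !oconjK opprK.
  by apply: octP => i _; rewrite !(ocD, ocN, ocZ); field.
- by rewrite /w; oct_lin.
Qed.

(** * Rays in N_1^- and the action of N^- on them *)

Lemma jformZ (r : R) X Y : jform (r *: X) Y = r * jform X Y.
Proof.
case: X => [[[[[a1 a2] a3] x1] x2] x3]; rewrite -/(h1 _ _ _ _ _ _) h1Z.
by case: Y => [[[[[b1 b2] b3] y1] y2] y3]; rewrite /= !odotZl; ring.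
Qed.

Lemma N1mZ (r : R) X : 0 < r -> N1m X -> N1m (r *: X).
Proof.
case: X => [[[[[a1 a2] a3] x1] x2] x3] r0.
rewrite -/(h1 _ _ _ _ _ _) h1Z => /N1mE[[e1 e2 e3] [f1 f2 f3] t0 a10].
apply/N1mE; rewrite !(odotZl, odotZr, omulZl, omulZr, oconjZ) e1 e2 e3 f1 f2 f3.
split; last by rewrite pmulr_rlt0.
- by split; ring.
- by split; oct_lin.
- by rewrite -!mulrDr t0 mulr0.
Qed.

Lemma clsZ (r : R) X : 0 < r -> cls (r *: X) = cls X.
Proof.
move=> r0; apply/seteqP; split=> Y [NY [s s0 YE]]; split=> //.
- by exists (s * r); [exact: mulr_gt0|rewrite YE scalerA].
- exists (s / r); first exact: divr_gt0.
  by rewrite scalerA divfK // gt_eqF.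
Qed.

Lemma cls_self X : N1m X -> cls X X.
Proof. by move=> NX; split=> //; exists 1 => //; rewrite scale1r. Qed.

(** By homogeneity every representative r X contributes the same class, so the union in [actF]
    collapses. *)
Lemma actF_cls (g : J1 R -> J1 R) X : N1m X ->
  (forall r : R, g (r *: X) = r *: g X) -> actF g (cls X) = cls (g X).
Proof.
move=> NX gZ; apply/seteqP; split=> [Y [_ [_ [r r0 ->]]]|Y gY].
  by rewrite gZ clsZ.
by exists X => //; exact: cls_self.
Qed.

Lemma NmP (g : J1 R -> J1 R) :
  Nm g <-> exists x p, ore p = 0 /\ g = expL (Lm x p).
Proof.
split=> [[x _ [p /=]]|[x [p [p0 ->]]]].
  by rewrite ImOE => /eqP p0 <-; exists x, p.
by exists x => //; exists p => //=; rewrite ImOE p0.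
Qed.

(** Shared by both base points: [Y] is [horo] for P^- and constant for sigma P^-. Nilpotency at [X]
    supplies the homogeneity of exp L there. *)
Lemma Norbit_cls (Y : oct R -> oct R -> J1 R) X : N1m X ->
  (forall x p, ore p = 0 -> expL (Lm x p) X = Y x p) ->
  (forall x p, ore p = 0 -> exists m, iter m (Lm x p) X = 0) ->
  Norbit (cls X) =
  [set C | exists x p, ore p = 0 /\ C = cls (Y x p)].
Proof.
move=> NX XY nilp.
have act x p : ore p = 0 -> actF (expL (Lm x p)) (cls X) = cls (Y x p).
  move=> p0; have [m nil_m] := nilp x p p0.
  rewrite -XY // actF_cls // => r; exact: (expLZ r (@LmZ x p) nil_m).
apply/seteqP; split=> C.
  by move=> [g /NmP[x [p [p0 ->]]] <-]; exists x, p; rewrite act.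
move=> [x [p [p0 ->]]]; exists (expL (Lm x p)); last exact: act.
by apply/NmP; exists x, p.
Qed.

(** * The orbits of [P^-] and [sigma P^-] *)

Lemma N1m_Pm : N1m (Pm R).
Proof.
apply/N1mE; rewrite !(omul0l, omul0r, oconj0, odot0l, odot1r) /ore oc_e //=.
by split; rewrite ?ltrN10 //; try split; (ring || oct_lin).
Qed.

Lemma N1m_sigma_Pm : N1m (jsigma (Pm R)).
Proof.
rewrite Pm_sigma; apply/N1mE.
rewrite !(omul0l, omul0r, oconj0, odot0l, odotNl, odotNr, odot1r) /ore oc_e //=.
by split; rewrite ?ltrN10 //; try split; (ring || oct_lin).
Qed.

Lemma Lm_sigma_Pm x p : ore p = 0 -> Lm x p (jsigma (Pm R)) = 0.
Proof.
move=> p0; rewrite Pm_sigma LmE.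
rewrite !(omul0l, omul0r, odot0r, odotNr, odot1r, oconjN, oconj0, oconj1).
rewrite !(omulNl, omulNr, omul1x, omulx1) p0.
by congr h1; (ring || oct_lin).
Qed.

Lemma expL_sigma_Pm x p : ore p = 0 ->
  expL (Lm x p) (jsigma (Pm R)) = jsigma (Pm R).
Proof.
move=> p0; rewrite (@expL_finite _ _ _ 1) ?Lm0 //; last exact: Lm_sigma_Pm.
by rewrite big_nat1 fact0 invr1 scale1r.
Qed.

Lemma Norbit_Pm : Norbit (cls (Pm R)) =
  [set cls X | X in [set X | N1m X /\ jform X (jsigma (Pm R)) != 0]].
Proof.
rewrite (Norbit_cls N1m_Pm expL_Pm) => [|x p p0]; last first.
  by exists 5; rewrite Lm_iter //= scaler0.
apply/seteqP; split=> C.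
  move=> [x [p [p0 ->]]]; exists (horo x p) => //; split; first exact: N1m_horo.
  by rewrite jform_horo // pnatr_eq0.
move=> [X [NX X0] <-].
have s0 : 0 < jform X (jsigma (Pm R)) by rewrite lt_def X0 N1m_jform_ge0.
(* Rescaling by this positive factor keeps the class and moves X to the slice parametrized by
   [horo]. *)
have r0 : 0 < 4 / jform X (jsigma (Pm R)) by rewrite divr_gt0.
have [||x [p [p0 E]]] := @N1m_eq_horo ((4 / jform X (jsigma (Pm R))) *: X).
- exact: N1mZ.
- by rewrite jformZ divfK.
- by exists x, p; split=> //; rewrite -E clsZ.
Qed.

Lemma Norbit_sigma_Pm :
  Norbit (cls (jsigma (Pm R))) = [set cls (jsigma (Pm R))].
Proof.
rewrite (Norbit_cls N1m_sigma_Pm expL_sigma_Pm) => [|x p p0]; last first.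
  by exists 1; rewrite /= Lm_sigma_Pm.
apply/seteqP; split=> C; first by move=> [x [p [_ ->]]].
by move=> ->; exists 0, 0; split=> //; rewrite /ore oc0.
Qed.

Lemma jform_sigma_Pm_eq0 :
  [set cls X | X in [set X | N1m X /\ jform X (jsigma (Pm R)) = 0]] =
  [set cls (jsigma (Pm R))].
Proof.
apply/seteqP; split=> C.
  by move=> [X [NX X0] <-]; have [r r0 ->] := N1m_jform_eq0 NX X0; rewrite clsZ.
move=> ->; exists (jsigma (Pm R)) => //; split; first exact: N1m_sigma_Pm.
by rewrite {1}Pm_sigma jform_sigma_Pm /ore ocN oc_e //=; ring.
Qed.

End Orbits.

Theorem theorem9p9 (R : realType) :
  let P := Pm R in
  let sP := jsigma P in
  [/\ Fq R = Norbit (cls P) `|` Norbit (cls sP),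
      Norbit (cls P) `&` Norbit (cls sP) = set0,
      Norbit (cls P) = [set cls X | X in [set X | N1m X /\ 0 < jform X sP]]
      /\ Norbit (cls P) = [set cls X | X in [set X | N1m X /\ jform X sP != 0]]
    & Norbit (cls sP) = [set cls X | X in [set X | N1m X /\ jform X sP = 0]]
      /\ Norbit (cls sP) = [set cls sP]].
Proof.
(* Both orbits become conditions on the form, nonzero and zero, so the decomposition reduces to this
   dichotomy. *)
move=> P sP; rewrite Norbit_Pm Norbit_sigma_Pm -jform_sigma_Pm_eq0.
split=> //.
- apply/seteqP; split=> [C [X NX <-]|C].
    by have [X0|X0] := eqVneq (jform X sP) 0; [right|left]; exists X.
  by case=> -[X [NX _] <-]; exists X.
- apply/seteqP; split=> // C [[X [NX X0] <-] [Y [NY Y0] YX]].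
  (* Equal classes make X a multiple of Y, where the form vanishes. *)
  have [_ [r r0 XE]] : cls Y X by rewrite YX; exact: cls_self.
  by move: X0; rewrite XE jformZ Y0 mulr0 eqxx.
- split=> //; apply/seteqP; split=> C [X [NX X0] <-]; exists X => //; split=> //.
    by rewrite lt_def X0 N1m_jform_ge0.
  by rewrite gt_eqF.
Qed.
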